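(* The category $\mathsf{bGA}$ of Gödel algebras with Boolean constant is dually equivalent to the category $\mathsf{bGS}$ of bG-spaces.
   Context: A Gödel algebra is $(A,\wedge,\vee,\to,t,\bot)$ with $(A,\wedge,\vee)$ a bounded lattice with top $t$ and bottom $\bot$, $a\wedge b\le c\iff a\le b\to c$, and $(a\to b)\vee(b\to a)=t$. A bG-algebra is a Gödel algebra with a constant $f$ satisfying $a\vee(a\to f)=t$ for all $a$; $\mathsf{bGA}$ has all homomorphisms as morphisms. A Priestley space $(X,\le,\tau)$ is a compact space with a partial order such that $x\not\le y$ implies some clopen up-set contains $x$ but not $y$; it is Esakia if $\downarrow U$ is clopen for all clopen $U$. A poset is a forest if ${\uparrow}x$ is a chain for every $x$. A bG-space is $(X,\le,D,\tau)$ where $(X,\le,\tau)$ is an Esakia space, $(X,\le)$ is a forest, and $D$ is a clopen set of $\le$-minimal elements. A $\mathsf{bGS}$-morphism $\varphi\colon X\to Y$ is a continuous p-morphism ($\varphi$ isotone and $\varphi(x)\le z$ implies $\exists y\ge x$ with $\varphi(y)=z$) with $\varphi[D_X]\subseteq D_Y$ and $\varphi[X\setminus D_X]\subseteq Y\setminus D_Y$. *)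

(* Defs.v *)
From HB Require Import structures.
From mathcomp Require Import all_boot all_order.
From mathcomp Require Import all_classical topology.

Set Implicit Arguments.
Unset Strict Implicit.
Unset Printing Implicit Defensive.

Local Open Scope classical_set_scope.

(** * Categories *)

Record category := Category {
  obj :> Type;
  hom : obj -> obj -> Type;
  idm : forall X, hom X X;
  compose : forall X Y Z, hom Y Z -> hom X Y -> hom X Z;
  compose_idl : forall X Y (f : hom X Y), compose (idm Y) f = f;
  compose_idr : forall X Y (f : hom X Y), compose f (idm X) = f;
  composeA : forall W X Y Z (f : hom Y Z) (g : hom X Y) (h : hom W X),
    compose f (compose g h) = compose (compose f g) h
}.

Arguments idm {c} X.
Arguments compose {c X Y Z} g f.

Definition opposite (C : category) : category :=
  @Category C (fun X Y => hom Y X) (fun X => idm X)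
    (fun X Y Z g f => compose f g)
    (fun X Y f => compose_idr f)
    (fun X Y f => compose_idl f)
    (fun W X Y Z f g h => esym (composeA h g f)).

Record functor (C D : category) := Functor {
  fobj :> C -> D;
  fmap : forall X Y, hom X Y -> hom (fobj X) (fobj Y);
  fmap_id : forall X, fmap (idm X) = idm (fobj X);
  fmap_compose : forall X Y Z (g : hom Y Z) (f : hom X Y),
    fmap (compose g f) = compose (fmap g) (fmap f)
}.

Arguments fmap {C D} f0 {X Y} f.

Definition functor_id (C : category) : functor C C :=
  @Functor C C (fun X => X) (fun X Y f => f)
    (fun X => erefl) (fun X Y Z g f => erefl).

Lemma functor_comp_id (C D E : category) (G : functor D E) (F : functor C D)
  (X : C) : fmap G (fmap F (idm X)) = idm (G (F X)).
Proof. by rewrite !fmap_id. Qed.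

Lemma functor_comp_compose (C D E : category) (G : functor D E)
  (F : functor C D) (X Y Z : C) (g : hom Y Z) (f : hom X Y) :
  fmap G (fmap F (compose g f)) =
  compose (fmap G (fmap F g)) (fmap G (fmap F f)).
Proof. by rewrite !fmap_compose. Qed.

Definition functor_comp (C D E : category) (G : functor D E)
    (F : functor C D) : functor C E :=
  @Functor C E (fun X => G (F X)) (fun X Y f => fmap G (fmap F f))
    (functor_comp_id G F) (@functor_comp_compose C D E G F).

Definition is_iso (C : category) (X Y : C) (f : hom X Y) : Prop :=
  exists g : hom Y X, compose g f = idm X /\ compose f g = idm Y.

Definition naturally_isomorphic (C D : category) (F G : functor C D) : Prop :=
  exists eta : forall X : C, hom (F X) (G X),
    (forall (X Y : C) (f : hom X Y),
       compose (eta Y) (fmap F f) = compose (fmap G f) (eta X)) /\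
    (forall X : C, is_iso (eta X)).

Definition equivalent (C D : category) : Prop :=
  exists (F : functor C D) (G : functor D C),
    naturally_isomorphic (functor_id C) (functor_comp G F) /\
    naturally_isomorphic (functor_comp F G) (functor_id D).

Definition dually_equivalent (C D : category) : Prop :=
  equivalent (opposite C) D.

(* MathComp's order structures are indexed by a display, which only drives the
   printing of notations; all objects below use the default one. *)
Local Notation disp := (Order.Disp tt tt).

(** * Gödel algebras with a Boolean constant *)

Record is_godel_algebra (A : tbLatticeType disp) (imp : A -> A -> A) : Prop :=
  IsGodelAlgebra {
    godel_residuation :
      forall a b c : A, (a `&` b <= c)%O <-> (a <= imp b c)%O;
    godel_prelinearity : forall a b : A, (imp a b `|` imp b a)%O = \top%O
  }.

Record bGalgebra := BGAlgebra {
  bGa_lattice :> tbLatticeType disp;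
  imp : bGa_lattice -> bGa_lattice -> bGa_lattice;
  bconst : bGa_lattice;
  bGa_godel : is_godel_algebra imp;
  bGa_bool : forall a : bGa_lattice, (a `|` imp a bconst)%O = \top%O
}.

Arguments imp {b} a b : rename.
Arguments bconst {b}.

Record is_bGhom (A B : bGalgebra) (h : A -> B) : Prop := IsBGHom {
  bGhom_meet : forall a b, h (a `&` b)%O = (h a `&` h b)%O;
  bGhom_join : forall a b, h (a `|` b)%O = (h a `|` h b)%O;
  bGhom_imp : forall a b, h (imp a b) = imp (h a) (h b);
  bGhom_top : h \top%O = \top%O;
  bGhom_bot : h \bot%O = \bot%O;
  bGhom_const : h bconst = bconst
}.

Record bGhom (A B : bGalgebra) := BGHom {
  bGhom_fun :> A -> B;
  bGhomP : is_bGhom bGhom_fun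
}.

Lemma bGhom_eq (A B : bGalgebra) (g h : bGhom A B) :
  bGhom_fun g = bGhom_fun h -> g = h.
Proof.
case: g h => [g gP] [h hP] /= gh; case: _ / gh hP => hP.
by congr BGHom; exact: Prop_irrelevance.
Qed.

Lemma is_bGhom_id (A : bGalgebra) : is_bGhom (fun a : A => a).
Proof. by []. Qed.

Lemma is_bGhom_comp (A B C : bGalgebra) (h : bGhom B C) (g : bGhom A B) :
  is_bGhom (fun a => h (g a)).
Proof.
by case: h g => [h []] hI hU him hT hB hc [g []] gI gU gim gT gB gc; split => /=
  [a b|a b|a b|||]; rewrite ?(gI, gU, gim, gT, gB, gc)
                            ?(hI, hU, him, hT, hB, hc).
Qed.

Definition bGhom_id (A : bGalgebra) : bGhom A A := BGHom (is_bGhom_id A).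

Definition bGhom_comp (A B C : bGalgebra) (h : bGhom B C) (g : bGhom A B) :
  bGhom A C := BGHom (is_bGhom_comp h g).

Lemma bGhom_compidl (A B : bGalgebra) (h : bGhom A B) :
  bGhom_comp (bGhom_id B) h = h.
Proof. exact: bGhom_eq. Qed.

Lemma bGhom_compidr (A B : bGalgebra) (h : bGhom A B) :
  bGhom_comp h (bGhom_id A) = h.
Proof. exact: bGhom_eq. Qed.

Lemma bGhom_compA (A B C D : bGalgebra) (f : bGhom C D) (g : bGhom B C)
  (h : bGhom A B) :
  bGhom_comp f (bGhom_comp g h) = bGhom_comp (bGhom_comp f g) h.
Proof. exact: bGhom_eq. Qed.

Definition bGA : category :=
  @Category bGalgebra bGhom bGhom_id bGhom_comp
    bGhom_compidl bGhom_compidr bGhom_compA.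

(** * bG-spaces *)

Section OrderedSpaces.
Variable X : POrderedTopological.type disp.

Definition up_set (U : set X) : Prop :=
  forall x y : X, U x -> (x <= y)%O -> U y.

Definition down_closure (U : set X) : set X :=
  [set x | exists2 y, U y & (x <= y)%O].

Definition priestley_space : Prop :=
  compact [set: X] /\
  forall x y : X, ~ (x <= y)%O ->
    exists U : set X, [/\ clopen U, up_set U, U x & ~ U y].

Definition esakia_space : Prop :=
  priestley_space /\ forall U : set X, clopen U -> clopen (down_closure U).

Definition forest : Prop :=
  forall x y z : X, (x <= y)%O -> (x <= z)%O -> (y <= z)%O \/ (z <= y)%O.

Definition minimal_elt (x : X) : Prop := forall y : X, (y <= x)%O -> y = x.

End OrderedSpaces.

Record bGspace := BGSpace {
  bGs_space :> POrderedTopological.type disp;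
  bGs_D : set bGs_space;
  bGs_esakia : esakia_space bGs_space;
  bGs_forest : forest bGs_space;
  bGs_clopen : clopen bGs_D;
  bGs_minimal : forall x, bGs_D x -> minimal_elt x
}.

Record is_bGmorphism (X Y : bGspace) (phi : X -> Y) : Prop := IsBGMorphism {
  bGm_continuous : continuous phi;
  bGm_isotone : forall x y : X, (x <= y)%O -> (phi x <= phi y)%O;
  bGm_lift : forall (x : X) (z : Y), (phi x <= z)%O ->
    exists2 y : X, (x <= y)%O & phi y = z;
  bGm_D : phi @` (@bGs_D X) `<=` @bGs_D Y;
  bGm_setCD : phi @` (~` @bGs_D X) `<=` ~` (@bGs_D Y)
}.

Record bGmorphism (X Y : bGspace) := BGMorphism {
  bGm_fun :> X -> Y;
  bGmP : is_bGmorphism bGm_fun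
}.

Lemma bGm_eq (X Y : bGspace) (f g : bGmorphism X Y) :
  bGm_fun f = bGm_fun g -> f = g.
Proof.
case: f g => [f fP] [g gP] /= fg; case: _ / fg gP => gP.
by congr BGMorphism; exact: Prop_irrelevance.
Qed.

Lemma is_bGmorphism_id (X : bGspace) : is_bGmorphism (fun x : X => x).
Proof.
split => //; first by move=> x.
- by move=> x z xz; exists z.
- by move=> _ [x Dx <-].
- by move=> _ [x Dx <-].
Qed.

Lemma is_bGmorphism_comp (X Y Z : bGspace) (g : bGmorphism Y Z)
  (f : bGmorphism X Y) : is_bGmorphism (fun x => g (f x)).
Proof.
case: g f => [g [gc gi gl gD gC]] [f [fc fi fl fD fC]]; split => /=.
- by move=> x; apply: continuous_comp; [exact: fc|exact: gc].
- by move=> x y /fi/gi.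
- move=> x z /gl[y /fl[x' xx' <-] <-]; by exists x'.
- by move=> _ [x Dx <-]; apply: gD; exists (f x) => //; apply: fD; exists x.
- by move=> _ [x Dx <-]; apply: gC; exists (f x) => //; apply: fC; exists x.
Qed.

Definition bGm_id (X : bGspace) : bGmorphism X X :=
  BGMorphism (is_bGmorphism_id X).

Definition bGm_comp (X Y Z : bGspace) (g : bGmorphism Y Z)
  (f : bGmorphism X Y) : bGmorphism X Z := BGMorphism (is_bGmorphism_comp g f).

Lemma bGm_compidl (X Y : bGspace) (f : bGmorphism X Y) :
  bGm_comp (bGm_id Y) f = f.
Proof. exact: bGm_eq. Qed.

Lemma bGm_compidr (X Y : bGspace) (f : bGmorphism X Y) :
  bGm_comp f (bGm_id X) = f.
Proof. exact: bGm_eq. Qed.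

Lemma bGm_compA (W X Y Z : bGspace) (f : bGmorphism Y Z) (g : bGmorphism X Y)
  (h : bGmorphism W X) :
  bGm_comp f (bGm_comp g h) = bGm_comp (bGm_comp f g) h.
Proof. exact: bGm_eq. Qed.

Definition bGS : category :=
  @Category bGspace bGmorphism bGm_id bGm_comp
    bGm_compidl bGm_compidr bGm_compA.

(* Main.v *)
(** Esakia duality, restricted to forests with a marked clopen set of minimal
    points.  An algebra is sent to its space of prime filters and a space to its
    lattice of clopen up-sets, where [U -> V] is the complement of the
    down-closure of [U \ V].  Prelinearity makes the prime filters a forest, and
    [a \/ (a -> f) = t] makes those omitting [f] minimal.  The crux is that the
    down-closure of [stone a \ stone b] is the complement of
    [stone (a -> b)]: by compactness the down-closure of any clopen set is then
    the complement of some [stone c], which yields both the Esakia condition and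
    the surjectivity of the Stone map. *)

From HB Require Import structures.
From mathcomp Require Import all_boot all_order all_classical topology.
Require Import Defs.

Set Implicit Arguments.
Unset Strict Implicit.
Unset Printing Implicit Defensive.

Import Order.Theory.

Local Open Scope classical_set_scope.

Local Notation disp := (Order.Disp tt tt).

(* Lets prime filters and clopen up-sets, which coerce to [set], be applied to
   points. *)
Identity Coercion Funclass_of_set : set >-> Funclass.

(** * Compact and Priestley spaces *)

Lemma compact_induction (T : topologicalType) (K : set T) (Q : set_system T) :
  Q set0 -> (forall A B, A `<=` B -> Q B -> Q A) ->
  (forall A B, Q A -> Q B -> Q (A `|` B)) ->
  (forall x, K x -> exists2 N, nbhs x N & Q N) ->
  compact K -> Q K.
Proof.
move=> Q0 Qsub QU Qloc cK; apply: contrapT => nQK.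
pose F : set_system T := [set A | Q (K `\` A)].
have FF : ProperFilter F.
  split; first by rewrite /F /= setD0.
  split=> [|A B FA FB|A B AB]; rewrite /F /=.
  - by rewrite setDT.
  - by rewrite setDIr; exact: QU.
  - by apply: Qsub; exact: setDS.
have [|x [Kx clx]] := cK F FF; first by rewrite /F /= setDv.
have [N xN QN] := Qloc x Kx.
have FCN : F (~` N) by rewrite /F /= setDE setCK; apply: Qsub QN => y [].
by have [y []] := clx _ _ FCN xN.
Qed.

Lemma closed_image_compact (X Y : topologicalType) (f : X -> Y) (C : set X) :
  compact [set: X] -> hausdorff_space Y -> continuous f ->
  closed C -> closed (f @` C).
Proof.
move=> cX hY fc cC; apply: compact_closed => //; apply: continuous_compact.
  exact: continuous_subspaceT.
exact: subclosed_compact cC cX _.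
Qed.

Lemma continuous_inverse_compact (X Y : topologicalType)
    (f : X -> Y) (g : Y -> X) :
  compact [set: X] -> hausdorff_space Y -> continuous f ->
  cancel f g -> cancel g f -> continuous g.
Proof.
move=> cX hY fc fK gK; apply/continuous_closedP => C cC.
suff -> : g @^-1` C = f @` C by exact: closed_image_compact.
apply/seteqP; split=> [y Cgy|_ [x Cx <-]]; first by exists (g y).
by rewrite /= fK.
Qed.

Lemma zero_dimensional_hausdorff (T : topologicalType) :
  zero_dimensional T -> hausdorff_space T.
Proof.
move=> zT x y clxy; apply: contrapT => /eqP/zT[U [[oU cU] Ux nUy]].
have [||z []//] := clxy U (~` U); apply: open_nbhs_nbhs; split => //.
exact: closed_openC.
Qed.

Lemma priestley_zero_dimensional (X : POrderedTopological.type disp) :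
  priestley_space X -> zero_dimensional X.
Proof.
move=> [_ sep] x y /eqP xy.
have [le_xy|/sep[U [cU _ Ux nUy]]] := pselect (x <= y)%O; last by exists U.
have [|U [cU _ Uy nUx]] := sep y x.
  by move=> le_yx; apply: xy; apply/le_anti/andP.
by exists (~` U); split; [exact: clopenC setT cU|by []|by apply].
Qed.

Lemma priestley_hausdorff (X : POrderedTopological.type disp) :
  priestley_space X -> hausdorff_space X.
Proof. by move=> /priestley_zero_dimensional/zero_dimensional_hausdorff. Qed.

Lemma up_setC_down_closure (X : POrderedTopological.type disp)
    (S : set X) : up_set (~` down_closure S).
Proof.
by move=> x y nx xy [z Sz yz]; apply: nx; exists z => //; exact: le_trans yz.
Qed.

(** * Prime filters *)

Section MeetClosed.
Context {d : Order.disp_t} {L : latticeType d}.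
Implicit Types (S T M : set L) (a b : L).

Definition meet_closed S := forall a b, S a -> S b -> S (a `&` b)%O.

Definition join_closed S := forall a b, S a -> S b -> S (a `|` b)%O.

Definition nowhere_le S T := forall a b, S a -> T b -> ~ (a <= b)%O.

Lemma meet_closed_bigcup_chain S (C : set (set L)) :
  meet_closed S -> (forall M, C M -> meet_closed (S `|` M)) ->
  total_on C subset -> meet_closed (S `|` \bigcup_(M in C) M).
Proof.
move=> SI CI tot.
have inC M : C M -> S `|` M `<=` S `|` \bigcup_(M in C) M.
  by move=> CM; apply: setUS; exact: bigcup_sup.
move=> a b [Sa|[M CM Ma]] [Sb|[N CN Nb]].
- by left; exact: SI.
- by apply: (inC N CN); apply: CI => //; [left|right].
- by apply: (inC M CM); apply: CI => //; [right|left].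
- have [MN|NM] := tot M N CM CN.
    by apply: (inC N CN); apply: CI; [|right; exact: MN|right].
  by apply: (inC M CM); apply: CI; [|right|right; exact: NM].
Qed.

Lemma ex_maximal_meet_closed S T :
  S !=set0 -> meet_closed S -> nowhere_le S T ->
  exists M, [/\ S `<=` M, meet_closed M, nowhere_le M T &
    forall a, nowhere_le [set (m `&` a)%O | m in M] T -> M a].
Proof.
move=> [s Ss] SI ST.
(* The condition bears on [S `|` N] so that it also holds when [N] is the union
   of the empty chain. *)
pose good N := meet_closed (S `|` N) /\ nowhere_le (S `|` N) T.
have [C Cgood tot|N [[MI MT] Nmax]] := @Zorn_bigcup L good.
  split=> [|a b [Sa|[N CN Na]] Tb]; last 2 first.
  - exact: ST.
  - by apply: (Cgood N CN).2 => //; right.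
  by apply: meet_closed_bigcup_chain => // N /Cgood[].
exists (S `|` N); split=> [b Sb|//|//|a aT]; first by left.
pose H := [set c | exists2 m, (S `|` N) m & (m `&` a <= c)%O].
have MH : S `|` N `<=` H by move=> m Mm; exists m => //; exact: leIl.
have SH : S `|` H = H by apply/setUidr => b Sb; apply: MH; left.
have Ha : H a by exists s; [left|exact: leIr].
apply: contrapT => nMa; apply: (Nmax H).
  split=> [b Nb|/(_ a Ha) Na]; first by apply: MH; right.
  by apply: nMa; right.
rewrite /good SH; split=> [b c [m Mm mb] [n Mn nc]|b c [m Mm mb] Tc bc].
  by exists (m `&` n)%O; [exact: MI|rewrite -[a]meetxx meetACA leI2].
by apply: (aT (m `&` a)%O c) => //; [exists m|exact: le_trans mb bc].
Qed.

End MeetClosed.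

(* Equivalently, the indicator function of [P] is a homomorphism of bounded
   lattices to [Prop]; in particular [P] is an up-set. *)
Record prime_filter (d : Order.disp_t) (L : tbLatticeType d) (P : set L) :
    Prop := PrimeFilter {
  prime_top : P \top%O;
  prime_bot : ~ P \bot%O;
  prime_meet : forall a b, P (a `&` b)%O <-> P a /\ P b;
  prime_join : forall a b, P (a `|` b)%O <-> P a \/ P b
}.

Record spectrum (d : Order.disp_t) (L : tbLatticeType d) := Spectrum {
  spec_set :> set L;
  spec_setP : spec_set \in (@prime_filter d L : set (set L))
}.

HB.instance Definition _ (d : Order.disp_t) (L : tbLatticeType d) :=
  [isSub of spectrum L for @spec_set d L].
HB.instance Definition _ (d : Order.disp_t) (L : tbLatticeType d) :=
  [Choice of spectrum L by <:].
HB.instance Definition _ (d : Order.disp_t) (L : tbLatticeType d) :=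
  [SubChoice_isSubPOrder of spectrum L by <: with disp].

Section Spectrum.
Context {d : Order.disp_t} {L : tbLatticeType d}.
Implicit Types (P Q : spectrum L) (a b : L).

Lemma spec_prime P : prime_filter P.
Proof. exact: set_mem (spec_setP P). Qed.

Lemma spec_leP P Q : (P <= Q)%O <-> P `<=` Q.
Proof. by split=> /subsetPset. Qed.

Lemma spec_top P : P \top%O.
Proof. exact: prime_top (spec_prime P). Qed.

Lemma spec_bot P : ~ P \bot%O.
Proof. exact: prime_bot (spec_prime P). Qed.

Lemma spec_meet P a b : P (a `&` b)%O <-> P a /\ P b.
Proof. exact: prime_meet (spec_prime P) a b. Qed.

Lemma spec_join P a b : P (a `|` b)%O <-> P a \/ P b.
Proof. exact: prime_join (spec_prime P) a b. Qed.

Lemma spec_up P a b : (a <= b)%O -> P a -> P b.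
Proof. by move=> /meet_l <- /spec_meet[]. Qed.

Definition stone a : set (spectrum L) := [set P | P a].

Lemma stone_top : stone \top%O = setT.
Proof. by apply/seteqP; split=> // P _; exact: spec_top. Qed.

Lemma stone_bot : stone \bot%O = set0.
Proof. by apply/seteqP; split=> // P /spec_bot. Qed.

Lemma stone_meet a b : stone (a `&` b)%O = stone a `&` stone b.
Proof. by apply/seteqP; split=> P /spec_meet. Qed.

Lemma stone_join a b : stone (a `|` b)%O = stone a `|` stone b.
Proof. by apply/seteqP; split=> P /spec_join. Qed.

Definition spec_nbhs P : set_system (spectrum L) :=
  filter_from [set ab | P ab.1 /\ ~ P ab.2]
    (fun ab => stone ab.1 `\` stone ab.2).

End Spectrum.

HB.instance Definition _ (d : Order.disp_t) (L : tbLatticeType d) :=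
  hasNbhs.Build (spectrum L) (@spec_nbhs d L).

Section SpectrumTopology.
Context {d : Order.disp_t} {L : tbLatticeType d}.
Implicit Types (P : spectrum L) (N : set (spectrum L)) (a b : L).

Lemma spec_nbhsP P N :
  nbhs P N <-> exists a b, [/\ P a, ~ P b & stone a `\` stone b `<=` N].
Proof.
split=> [[[a b] /= [Pa nPb] abN]|[a [b [Pa nPb abN]]]]; first by exists a, b.
by exists (a, b).
Qed.

Lemma spec_nbhs_filter P : ProperFilter (nbhs P).
Proof.
apply: filter_from_proper => [|[a b] [Pa nPb]]; last by exists P.
apply: filter_from_filter => [|[a b] [c e] /= [Pa nPb] [Pc nPe]].
  by exists (\top, \bot)%O; split; [exact: spec_top|exact: spec_bot].
exists (a `&` c, b `|` e)%O => /=.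
  by split; [exact/spec_meet|move=> /spec_join[]].
by rewrite stone_meet stone_join => Q [[Qa Qc] /not_orP[nQb nQe]].
Qed.

Lemma spec_nbhs_singleton P N : nbhs P N -> N P.
Proof. by move=> /spec_nbhsP[a [b [Pa nPb]]]; apply. Qed.

Lemma spec_nbhs_nbhs P N : nbhs P N -> nbhs P (nbhs^~ N).
Proof.
move=> /spec_nbhsP[a [b [Pa nPb abN]]]; apply/spec_nbhsP; exists a, b.
by split=> // Q [Qa nQb]; apply/spec_nbhsP; exists a, b.
Qed.

End SpectrumTopology.

HB.instance Definition _ (d : Order.disp_t) (L : tbLatticeType d) :=
  Nbhs_isNbhsTopological.Build (spectrum L) (@spec_nbhs_filter d L)
    (@spec_nbhs_singleton d L) (@spec_nbhs_nbhs d L).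

Section SpectrumPriestley.
Context {d : Order.disp_t} {L : tbLatticeType d}.
Implicit Types a b : L.

Lemma stone_up_set a : up_set (stone a).
Proof. by move=> P Q Pa /spec_leP; exact. Qed.

Lemma open_stoneD a b : open (stone a `\` stone b).
Proof. by rewrite openE => P [Pa nPb]; exists (a, b). Qed.

Lemma clopen_stone a : clopen (stone a).
Proof.
split; first by rewrite -[stone a]setD0 -stone_bot; exact: open_stoneD.
by rewrite -openC -setTD -stone_top; exact: open_stoneD.
Qed.

(* An ultrafilter [U] converges to the prime filter [{a | U (stone a)}]. *)
Lemma spec_compact : compact [set: spectrum L].
Proof.
rewrite compact_ultra => U UU _.
have FU : Filter U by exact: (@filter_filter _ _ ultra_proper).
have primeU : prime_filter [set a | U (stone a)].
  split=> [||a b|a b] /=.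
  - by rewrite stone_top; exact: filterT.
  - by rewrite stone_bot; exact: filter_not_empty.
  - rewrite stone_meet; split=> [Uab|[Ua Ub]]; last exact: filterI.
    by split; apply: filterS Uab => P [].
  - rewrite stone_join; split=> [Uab|[]]; last 2 first.
    + by apply: filterS; exact: subsetUl.
    + by apply: filterS; exact: subsetUr.
    have [Ua|nUa] := in_ultra_setVsetC (stone a) UU; [by left|right].
    by apply: filterS (filterI Uab nUa) => P [[]].
exists (Spectrum (mem_set primeU)); split=> // N.
move=> /spec_nbhsP[a [b [Ua nUb abN]]].
have [//|{}nUb] := in_ultra_setVsetC (stone b) UU.
exact: filterS (filterI Ua nUb).
Qed.

Lemma spec_priestley : priestley_space (spectrum L).
Proof.
split=> [|P Q nPQ]; first exact: spec_compact.
have [a /not_implyP[Pa nQa]] : exists a, ~ (P a -> Q a).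
  by apply/existsNP => PQ; apply/nPQ/spec_leP.
by exists (stone a); split; [exact: clopen_stone|exact: stone_up_set| |].
Qed.

End SpectrumPriestley.

(** * Prime filters of distributive lattices and Heyting algebras *)

Section DistributiveSpectrum.
Context {d : Order.disp_t} {L : tbLatticeType d}.
Hypothesis meet_distr : right_distributive (@Order.meet d L) (@Order.join d L).
Implicit Types (S T : set L) (a b : L).

Lemma prime_filter_separation S T :
  S !=set0 -> meet_closed S -> T !=set0 -> join_closed T -> nowhere_le S T ->
  exists P : spectrum L, S `<=` P /\ P `<=` ~` T.
Proof.
move=> S0 SI [t0 Tt0] TU ST.
have [M [SM MI MT Mmax]] := ex_maximal_meet_closed S0 SI ST.
have [s Ss] := S0.
have reach a : ~ M a -> exists m t, [/\ M m, T t & (m `&` a <= t)%O].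
  move=> nMa; apply: contrapT => nreach; apply: nMa; apply: Mmax.
  by move=> _ t [m Mm <-] Tt mat; apply: nreach; exists m, t.
have Mup a b : (a <= b)%O -> M a -> M b.
  move=> ab Ma; apply: Mmax => _ t [m Mm <-] Tt mbt.
  apply: (MT (m `&` a)%O t) => //; first exact: MI.
  by apply: le_trans mbt; exact: leI2.
have primeM : prime_filter M.
  split=> [||a b|a b].
  - exact: Mup (lex1 s) (SM s Ss).
  - by move=> /MT /(_ Tt0); apply; exact: le0x.
  - split=> [Mab|[]]; last exact: MI.
    by split; apply: Mup Mab; [exact: leIl|exact: leIr].
  - split=> [Mab|[]]; last 2 first.
    + exact: Mup (leUl a b).
    + exact: Mup (leUr b a).
    apply: contrapT => /not_orP[/reach[m [t [Mm Tt mat]]]].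
    move=> /reach[n [u [Mn Tu nbu]]].
    apply: (MT (m `&` n `&` (a `|` b))%O (t `|` u)%O).
    + by apply: (MI) => //; exact: MI.
    + exact: TU.
    rewrite meet_distr leU2 //.
      by apply: le_trans mat; rewrite leI2 // leIl.
    by apply: le_trans nbu; rewrite leI2 // leIr.
exists (Spectrum (mem_set primeM)); split=> // a Ma Ta.
exact: MT Ma Ta (lexx a).
Qed.

Lemma subset_stone a b : stone a `<=` stone b <-> (a <= b)%O.
Proof.
split=> [ab|ab P]; last exact: spec_up.
apply: contrapT => nab.
have [|_ _ -> ->||_ _ -> ->|_ _ -> ->|P [aP Pb]] :=
  @prime_filter_separation [set a] [set b].
- by exists a.
- by rewrite /= meetxx.
- by exists b.
- by rewrite /= joinxx.
- exact: nab.
exact: Pb (ab P (aP a erefl)) erefl.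
Qed.

Lemma stone_inj : injective (@stone d L).
Proof.
by move=> a b ab; apply/le_anti/andP; split; apply/subset_stone; rewrite ab.
Qed.

End DistributiveSpectrum.

Definition heyting_implication (d : Order.disp_t) (L : latticeType d)
    (imp : L -> L -> L) : Prop :=
  forall a b c : L, (a `&` b <= c)%O <-> (a <= imp b c)%O.

Lemma heyting_distributive (d : Order.disp_t) (L : latticeType d)
    (imp : L -> L -> L) :
  heyting_implication imp ->
  right_distributive (@Order.meet d L) (@Order.join d L).
Proof.
move=> impP a b c; apply/le_anti/andP; split; last first.
  by rewrite leUx !leI2 ?leUl ?leUr.
rewrite meetC; apply/impP; rewrite leUx.
by apply/andP; split; apply/impP; rewrite meetC; [exact: leUl|exact: leUr].
Qed.

Section HeytingSpectrum.
Context {d : Order.disp_t} {L : tbLatticeType d}.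
Variable imp : L -> L -> L.
Hypothesis impP : heyting_implication imp.
Implicit Types (P Q : spectrum L) (a b f : L) (C U : set (spectrum L)).

Let meet_distr := heyting_distributive impP.

Lemma spec_impP P a b :
  P (imp a b) <-> forall Q, (P <= Q)%O -> Q a -> Q b.
Proof.
split=> [Pab Q /spec_leP PQ Qa|PQab].
  have /spec_up : (imp a b `&` a <= b)%O by exact/impP.
  by apply; apply/spec_meet; split=> //; exact: PQ.
apply: contrapT => nPab.
have [|_ _ [p Pp <-] [q Pq <-]||_ _ -> ->|_ _ [p Pp <-] ->|Q [PQ Qb]] :=
  prime_filter_separation meet_distr (S := [set (p `&` a)%O | p in P])
                                     (T := [set b]).
- by exists (\top `&` a)%O; exists \top%O => //; exact: spec_top.
- exists (p `&` q)%O; first exact/spec_meet.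
  by rewrite -[in LHS](meetxx a) meetACA.
- by exists b.
- by rewrite /= joinxx.
- by move=> /impP pab; apply: nPab; exact: spec_up pab Pp.
have Q_meet p : P p -> Q p /\ Q a by move=> Pp; apply/spec_meet/PQ; exists p.
apply: (Qb b) => //; apply: PQab; first by apply/spec_leP => p /Q_meet[].
by have [] := Q_meet _ (spec_top P).
Qed.

Lemma down_closure_stoneD a b :
  down_closure (stone a `\` stone b) = ~` stone (imp a b).
Proof.
apply/seteqP; split=> [P [Q [Qa nQb] PQ] /spec_impP Pab|P nPab].
  exact: nQb (Pab Q PQ Qa).
apply: contrapT => nP; apply: nPab; apply/spec_impP => Q PQ Qa.
by apply: contrapT => nQb; apply: nP; exists Q.
Qed.

Lemma down_closure_clopen_stone C :
  clopen C -> exists c, down_closure C = ~` stone c.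
Proof.
move=> [oC cC].
(* [Q C] is the claim; splitting the equality makes [Q] stable under subsets. *)
pose Q S := exists c : L,
  down_closure S `<=` ~` stone c /\ ~` stone c `<=` down_closure C.
suff [c [C_c c_C]] : Q C by exists c; apply/seteqP.
apply: (@compact_induction _ C Q) => [|A B AB [c [B_c c_C]]||P CP|].
- by exists \top%O; rewrite stone_top setCT; split=> // P [R []].
- by exists c; split=> // P [R AR PR]; apply: B_c; exists R => //; exact: AB.
- move=> A B [a [A_a a_C]] [b [B_b b_C]]; exists (a `&` b)%O.
  rewrite stone_meet setCI; split=> [P [R [AR|BR] PR]|P [/a_C|/b_C]//].
    by left; apply: A_a; exists R.
  by right; apply: B_b; exists R.
- have /spec_nbhsP[a [b [Pa nPb abC]]] : nbhs P C by exact: open_nbhs_nbhs.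
  exists (stone a `\` stone b).
    by apply: open_nbhs_nbhs; split=> //; exact: open_stoneD.
  exists (imp a b); rewrite -down_closure_stoneD; split=> // R [T abT RT].
  by exists T => //; exact: abC.
- exact: subclosed_compact cC spec_compact _.
Qed.

Lemma clopen_up_stone U : clopen U -> up_set U -> exists a, stone a = U.
Proof.
move=> cU upU; have [a downCU] := down_closure_clopen_stone (clopenC setT cU).
exists a; apply: (can_inj setCK); rewrite -downCU.
apply/seteqP; split=> [P [Q nUQ PQ] UP|P nUP]; last by exists P.
by apply: nUQ; exact: upU UP PQ.
Qed.

Lemma spec_esakia : esakia_space (spectrum L).
Proof.
split=> [|U /down_closure_clopen_stone[c ->]]; first exact: spec_priestley.
exact: clopenC setT (clopen_stone c).
Qed.

Lemma spec_forest :
  (forall a b, (imp a b `|` imp b a)%O = \top%O) -> forest (spectrum L).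
Proof.
move=> prelinear P Q R PQ PR; apply: contrapT => /not_orP[].
move=> /spec_leP/existsNP[a /not_implyP[Qa nRa]].
move=> /spec_leP/existsNP[b /not_implyP[Rb nQb]].
have := spec_top P; rewrite -(prelinear a b).
by move=> /spec_join[/spec_impP/(_ Q PQ Qa)|/spec_impP/(_ R PR Rb)].
Qed.

Lemma spec_minimal f : (forall a, (a `|` imp a f)%O = \top%O) ->
  forall P, ~ P f -> minimal_elt P.
Proof.
move=> bool_f P nPf Q QP; apply/le_anti; rewrite QP /=; apply/spec_leP => a Pa.
have := spec_top Q; rewrite -(bool_f a).
by move=> /spec_join[//|/spec_impP/(_ P QP Pa)].
Qed.

End HeytingSpectrum.

(** * Clopen up-sets *)

Definition clopen_up_set (X : POrderedTopological.type disp) : set (set X) :=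
  [set U | clopen U /\ up_set U].

Record clopup (X : POrderedTopological.type disp) := ClopUp {
  clopup_set :> set X;
  clopup_setP : clopup_set \in @clopen_up_set X
}.

HB.instance Definition _ (X : POrderedTopological.type disp) :=
  [isSub of clopup X for @clopup_set X].
HB.instance Definition _ (X : POrderedTopological.type disp) :=
  [Choice of clopup X by <:].

Section ClopUpLattice.
Context {X : POrderedTopological.type disp}.

Lemma clopen_up_setI :
  {in @clopen_up_set X &, forall U V, (U `&` V)%O \in @clopen_up_set X}.
Proof.
move=> U V /set_mem[cU upU] /set_mem[cV upV]; apply/mem_set.
split; first exact: clopenI.
by move=> x y [Ux Vx] xy; split; [exact: upU xy|exact: upV xy].
Qed.

Lemma clopen_up_setU :
  {in @clopen_up_set X &, forall U V, (U `|` V)%O \in @clopen_up_set X}.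
Proof.
move=> U V /set_mem[cU upU] /set_mem[cV upV]; apply/mem_set.
split; first exact: clopenU.
by move=> x y [Ux|Vx] xy; [left; exact: upU xy|right; exact: upV xy].
Qed.

Lemma clopen_up_set0 : \bot%O \in @clopen_up_set X.
Proof. by apply/mem_set; split; [exact: clopen0|]. Qed.

Lemma clopen_up_setT : \top%O \in @clopen_up_set X.
Proof. by apply/mem_set; split; [exact: clopenT|]. Qed.

HB.instance Definition _ :=
  Order.SubChoice_isTBSubLattice.Build _ _ _ disp (clopup X)
    clopen_up_setI clopen_up_setU clopen_up_set0 clopen_up_setT.

Lemma clopup_clopen (U : clopup X) : clopen U.
Proof. by case: U => U /= /set_mem[]. Qed.

Lemma clopup_up_set (U : clopup X) : up_set U.
Proof. by case: U => U /= /set_mem[]. Qed.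

Lemma clopup_leP (U V : clopup X) : (U <= V)%O <-> U `<=` V.
Proof. by split=> /subsetPset. Qed.

End ClopUpLattice.

Section EsakiaImplication.
Context {X : POrderedTopological.type disp}.
Hypothesis esakiaX : esakia_space X.
Implicit Types U V W D : clopup X.

Lemma clopen_up_set_imp U V : ~` down_closure (U `\` V) \in @clopen_up_set X.
Proof.
apply/mem_set; split; last exact: up_setC_down_closure.
apply/(clopenC setT)/esakiaX.2/clopenI; first exact: clopup_clopen.
exact: clopenC setT (clopup_clopen V).
Qed.

Definition clopup_imp U V : clopup X := ClopUp (clopen_up_set_imp U V).

Lemma clopup_impP U V x :
  clopup_imp U V x <-> forall y, (x <= y)%O -> U y -> V y.
Proof.
split=> [nx y xy Uy|UV [y [Uy nVy] xy]]; last by apply: nVy; exact: UV.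
by apply: contrapT => nVy; apply: nx; exists y.
Qed.

Lemma clopup_heyting : heyting_implication clopup_imp.
Proof.
move=> U V W; rewrite !clopup_leP; split=> UVW x.
  move=> Ux; apply/clopup_impP => y xy Vy; apply: UVW; split=> //.
  exact: clopup_up_set xy.
by move=> [/UVW/clopup_impP + Vx]; exact.
Qed.

Lemma clopup_prelinear :
  forest X -> forall U V, (clopup_imp U V `|` clopup_imp V U)%O = \top%O.
Proof.
move=> forestX U V; apply/le_anti; rewrite lex1 /=; apply/clopup_leP => x _.
apply: contrapT => /not_orP[].
move=> /clopup_impP/existsNP[y /not_implyP[xy /not_implyP[Uy nVy]]].
move=> /clopup_impP/existsNP[z /not_implyP[xz /not_implyP[Vz nUz]]].
have [yz|zy] := forestX x y z xy xz.
  by apply: nUz; exact: clopup_up_set yz.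
by apply: nVy; exact: clopup_up_set zy.
Qed.

Lemma clopup_boolean D : (forall x, ~ D x -> minimal_elt x) ->
  forall U, (U `|` clopup_imp U D)%O = \top%O.
Proof.
move=> minD U; apply/le_anti; rewrite lex1 /=; apply/clopup_leP => x _.
have [Ux|nUx] := pselect (U x); [by left|right].
apply/clopup_impP => y xy Uy; apply: contrapT => nDy; apply: nUx.
by rewrite (minD y nDy x xy).
Qed.

End EsakiaImplication.

(** * The points of a Priestley space *)

Section PointFilter.
Context {X : POrderedTopological.type disp}.
Hypothesis priestleyX : priestley_space X.
Implicit Types x y : X.

Lemma prime_filter_point x : prime_filter [set U : clopup X | U x].
Proof. by split. Qed.

Definition point_filter x : spectrum (clopup X) :=
  Spectrum (mem_set (prime_filter_point x)).

Lemma point_filter_le x y : (point_filter x <= point_filter y)%O <-> (x <= y)%O.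
Proof.
split=> [/spec_leP xy|xy]; last first.
  by apply/spec_leP => U Ux; exact: clopup_up_set xy.
apply: contrapT => /priestleyX.2[U [cU upU Ux]]; apply.
exact: (xy (ClopUp (mem_set (conj cU upU))) Ux).
Qed.

Lemma point_filter_inj : injective point_filter.
Proof.
by move=> x y xy; apply/le_anti/andP; split; apply/point_filter_le; rewrite xy.
Qed.

Lemma point_filter_continuous : continuous point_filter.
Proof.
move=> x N /spec_nbhsP[U [V [Ux nVx UVN]]].
apply: (@filterS _ _ _ (U `\` V)) => [y [Uy nVy]|]; first exact: UVN.
apply: open_nbhs_nbhs; split=> //; rewrite setDE.
have [[oU _] [_ cV]] := (clopup_clopen U, clopup_clopen V).
by apply: openI => //; exact: closed_openC.
Qed.

(* The range is closed by compactness; it is dense because [U \in P] and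
   [V \notin P] force [U `\` V] to be nonempty. *)
Lemma point_filter_surj P : exists x, point_filter x = P.
Proof.
suff : closure (range point_filter) P.
  rewrite -(closure_id _).1; first by move=> [x _ <-]; exists x.
  apply: closed_image_compact closedT; first exact: priestleyX.1.
    exact/priestley_hausdorff/spec_priestley.
  exact: point_filter_continuous.
move=> N /spec_nbhsP[U [V [PU nPV UVN]]].
have [x [Ux nVx]] : (U `\` V) !=set0.
  apply/set0P/eqP; rewrite setD_eq0 => UV; apply: nPV.
  by apply: spec_up PU; exact/clopup_leP.
by exists (point_filter x); split; [exists x|exact: UVN].
Qed.

End PointFilter.

(** * The two functors *)

Lemma bGa_heyting (A : bGalgebra) : heyting_implication (@imp A).
Proof. exact: godel_residuation (bGa_godel A). Qed.

Definition spec_space (A : bGalgebra) : bGspace :=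
  BGSpace (spec_esakia (@bGa_heyting A))
    (spec_forest (@bGa_heyting A) (godel_prelinearity (bGa_godel A)))
    (clopenC setT (clopen_stone bconst))
    (spec_minimal (@bGa_heyting A) (@bGa_bool A)).

Section SpectrumMap.
Variables (A B : bGalgebra) (h : bGhom A B).

Lemma prime_filter_preimage (P : spectrum B) : prime_filter (h @^-1` P).
Proof.
have hP := bGhomP h; split=> [||a b|a b] /=.
- by rewrite (bGhom_top hP); exact: spec_top.
- by rewrite (bGhom_bot hP); exact: spec_bot.
- by rewrite (bGhom_meet hP); exact: spec_meet.
- by rewrite (bGhom_join hP); exact: spec_join.
Qed.

Definition spec_preimage (P : spec_space B) : spec_space A :=
  Spectrum (mem_set (prime_filter_preimage P)).

Lemma spec_preimage_continuous : continuous spec_preimage.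
Proof.
move=> P N /spec_nbhsP[a [b [Pa nPb abN]]].
by apply/spec_nbhsP; exists (h a), (h b); split=> // Q [Qa nQb]; exact: abN.
Qed.

Lemma spec_preimage_lift (P : spec_space B) (Q : spec_space A) :
  (spec_preimage P <= Q)%O -> exists2 R, (P <= R)%O & spec_preimage R = Q.
Proof.
have hP := bGhomP h; move=> /spec_leP PQ.
have [|_ _ [p Pp [q Qq <-]] [p' Pp' [q' Qq' <-]]||||R [SR RT]] :=
  prime_filter_separation (heyting_distributive (@bGa_heyting B))
    (S := [set (p `&` h q)%O | p in P & q in Q]) (T := h @` (~` Q)).
- exists (\top `&` h \top)%O, \top%O; first exact: spec_top.
  by exists \top%O => //; exact: spec_top.
- exists (p `&` p')%O; first exact/spec_meet.
  exists (q `&` q')%O; first exact/spec_meet.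
  by rewrite (bGhom_meet hP) meetACA.
- by exists (h \bot%O), \bot%O => //; exact: spec_bot.
- move=> _ _ [r nQr <-] [r' nQr' <-]; exists (r `|` r')%O.
    by move=> /spec_join[].
  by rewrite (bGhom_join hP).
- move=> _ _ [p Pp [q Qq <-]] [r nQr <-] /bGa_heyting.
  rewrite -(bGhom_imp hP) => pqr.
  have /(spec_impP (@bGa_heyting A)) Qqr : Q (imp q r).
    by apply: PQ; exact: spec_up pqr Pp.
  exact/nQr/(Qqr Q).
have R_meet p q : P p -> Q q -> R p /\ R (h q).
  by move=> Pp Qq; apply/spec_meet/SR; exists p => //; exists q.
exists R; first by apply/spec_leP => p /R_meet/(_ (spec_top Q))[].
apply/val_inj/seteqP; split=> q; last by move=> /(R_meet _ _ (spec_top P))[].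
by move=> Rq; apply: contrapT => nQq; apply: RT Rq _; exists q.
Qed.

Lemma is_bGmorphism_spec_preimage : is_bGmorphism spec_preimage.
Proof.
split.
- exact: spec_preimage_continuous.
- by move=> P Q /spec_leP PQ; apply/spec_leP => a; exact: PQ.
- exact: spec_preimage_lift.
- by move=> _ [P nPf <-] /=; rewrite (bGhom_const (bGhomP h)).
- by move=> _ [P Pf <-] /=; rewrite (bGhom_const (bGhomP h)).
Qed.

Definition spec_map : bGmorphism (spec_space B) (spec_space A) :=
  BGMorphism is_bGmorphism_spec_preimage.

End SpectrumMap.

Lemma spec_map_id (A : bGA) : spec_map (idm A) = idm (spec_space A : bGS).
Proof. by apply/bGm_eq/funext => P; exact: val_inj. Qed.

Lemma spec_map_comp (A B C : bGA) (g : bGhom B C) (f : bGhom A B) :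
  spec_map (bGhom_comp g f) = bGm_comp (spec_map f) (spec_map g).
Proof. by apply/bGm_eq/funext => P; exact: val_inj. Qed.

Definition spec_functor : functor (opposite bGA) bGS :=
  @Functor (opposite bGA) bGS spec_space (fun A B h => @spec_map B A h)
    spec_map_id (fun A B C g f => spec_map_comp f g).

Section ClopUpAlgebra.
Variable X : bGspace.

Lemma clopen_up_setC_D : ~` @bGs_D X \in @clopen_up_set X.
Proof.
apply/mem_set; split; first exact: clopenC setT (@bGs_clopen X).
by move=> x y nDx xy Dy; apply: nDx; rewrite (bGs_minimal Dy xy).
Qed.

Definition clopup_const : clopup X := ClopUp clopen_up_setC_D.

Lemma clopup_const_minimal (x : X) : ~ clopup_const x -> minimal_elt x.
Proof. by move=> /contrapT; exact: bGs_minimal. Qed.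

Definition clopup_alg : bGalgebra :=
  BGAlgebra
    (IsGodelAlgebra (clopup_heyting (bGs_esakia X))
      (clopup_prelinear (bGs_esakia X) (@bGs_forest X)))
    (clopup_boolean (bGs_esakia X) clopup_const_minimal).

End ClopUpAlgebra.

Section ClopUpMap.
Variables (X Y : bGspace) (f : bGmorphism X Y).

Lemma clopen_up_set_preimage (U : clopup Y) : f @^-1` U \in @clopen_up_set X.
Proof.
have fP := bGmP f; apply/mem_set; split=> [|x y Ux /(bGm_isotone fP)].
  exact: preimage_clopen (clopup_clopen U) (bGm_continuous fP).
exact: clopup_up_set.
Qed.

Definition clopup_preimage (U : clopup_alg Y) : clopup_alg X :=
  ClopUp (clopen_up_set_preimage U).

Lemma is_bGhom_clopup_preimage : is_bGhom clopup_preimage.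
Proof.
have fP := bGmP f; have impY := clopup_impP (bGs_esakia Y).
split=> [U V|U V|U V|||]; apply/val_inj/seteqP; split=> // x.
- move=> /impY UV; apply/clopup_impP => y /(bGm_isotone fP); exact: UV.
- move=> /clopup_impP UV; apply/impY => z /(bGm_lift fP)[y xy <-]; exact: UV.
- by move=> nDx Dx; apply: nDx; apply: (bGm_D fP); exists x.
- by move=> nDx; apply: (bGm_setCD fP); exists x.
Qed.

Definition clopup_map : bGhom (clopup_alg Y) (clopup_alg X) :=
  BGHom is_bGhom_clopup_preimage.

End ClopUpMap.

Lemma clopup_map_id (X : bGS) : clopup_map (idm X) = idm (clopup_alg X : bGA).
Proof. by apply/bGhom_eq/funext => U; exact: val_inj. Qed.

Lemma clopup_map_comp (X Y Z : bGS) (g : bGmorphism Y Z) (f : bGmorphism X Y) :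
  clopup_map (bGm_comp g f) = bGhom_comp (clopup_map f) (clopup_map g).
Proof. by apply/bGhom_eq/funext => U; exact: val_inj. Qed.

Definition clopup_functor : functor bGS (opposite bGA) :=
  @Functor bGS (opposite bGA) clopup_alg (fun X Y f => clopup_map f)
    clopup_map_id clopup_map_comp.

(** * The natural isomorphisms *)

Lemma is_iso_opposite (C : category) (X Y : C) (f : hom X Y) :
  is_iso f -> @is_iso (opposite C) Y X f.
Proof. by move=> [g [gf fg]]; exists g. Qed.

Lemma naturally_isomorphic_sym (C D : category) (F G : functor C D) :
  naturally_isomorphic F G -> naturally_isomorphic G F.
Proof.
move=> [eta [nat_eta iso_eta]].
pose inv X := sval (cid (iso_eta X)); have invP X := svalP (cid (iso_eta X)).
exists inv; split=> [X Y f|X].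
  rewrite -[fmap G f]compose_idr -(invP X).2 (composeA (fmap G f)) -nat_eta.
  by rewrite -(composeA (eta Y)) (composeA (inv Y)) (invP Y).1 compose_idl.
by exists (eta X); have [] := invP X.
Qed.

Lemma bGhom_bij_iso (A B : bGA) (h : bGhom A B) :
  bijective h -> @is_iso bGA A B h.
Proof.
move=> [g hK gK]; have hP := bGhomP h.
have gP : is_bGhom g.
  by split=> [a b|a b|a b|||]; apply: (can_inj hK);
    rewrite ?(bGhom_meet hP, bGhom_join hP, bGhom_imp hP) ?gK //
            ?(bGhom_top hP, bGhom_bot hP, bGhom_const hP).
by exists (BGHom gP); split; apply/bGhom_eq/funext => a /=; rewrite ?hK ?gK.
Qed.

Lemma bGm_bij_iso (X Y : bGS) (f : bGmorphism X Y) :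
  bijective f -> @is_iso bGS X Y f.
Proof.
move=> [g fK gK]; have fP := bGmP f.
have gP : is_bGmorphism g.
  split.
  - apply: continuous_inverse_compact fK gK; first exact: (bGs_esakia X).1.1.
      exact/priestley_hausdorff/(bGs_esakia Y).1.
    exact: bGm_continuous fP.
  - move=> y z; rewrite -{1}[y]gK => /(bGm_lift fP)[x gyx fx].
    by rewrite -fx fK.
  - move=> y x gyx; exists (f x) => //.
    by rewrite -[y]gK; exact: bGm_isotone fP _ _ gyx.
  - move=> _ [y Dy <-]; apply: contrapT => nDgy.
    suff: (~` @bGs_D Y) y by apply.
    by apply: (bGm_setCD fP); exists (g y).
  - by move=> _ [y nDy <-] Dgy; apply: nDy; apply: (bGm_D fP); exists (g y).
by exists (BGMorphism gP); split; apply/bGm_eq/funext => x /=; rewrite ?fK ?gK.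
Qed.

Section StoneHom.
Variable A : bGalgebra.

Lemma clopen_up_set_stone (a : A) : stone a \in @clopen_up_set (spec_space A).
Proof. by apply/mem_set; split; [exact: clopen_stone|exact: stone_up_set]. Qed.

Definition stone_clopup (a : A) : clopup_alg (spec_space A) :=
  ClopUp (clopen_up_set_stone a).

Lemma is_bGhom_stone : is_bGhom stone_clopup.
Proof.
split=> [a b|a b|a b|||]; apply: val_inj => /=.
- exact: stone_meet.
- exact: stone_join.
- by rewrite (down_closure_stoneD (@bGa_heyting A)) setCK.
- exact: stone_top.
- exact: stone_bot.
- by rewrite setCK.
Qed.

Definition stone_hom : bGhom A (clopup_alg (spec_space A)) :=
  BGHom is_bGhom_stone.

Lemma stone_hom_bij : bijective stone_hom.
Proof.
rewrite -setTT_bijective; split=> // [a b _ _ /(congr1 val)|U _].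
  exact/stone_inj/heyting_distributive/bGa_heyting.
have [a aU] :=
  clopen_up_stone (@bGa_heyting A) (clopup_clopen U) (clopup_up_set (U := U)).
by exists a => //; exact: val_inj.
Qed.

End StoneHom.

Lemma stone_hom_natural (A B : bGA) (h : bGhom A B) :
  bGhom_comp (clopup_map (spec_map h)) (stone_hom A) =
  bGhom_comp (stone_hom B) h.
Proof. by apply/bGhom_eq/funext => a; exact: val_inj. Qed.

Section PointMorphism.
Variable X : bGspace.

Let priestleyX : priestley_space X := (bGs_esakia X).1.

Lemma is_bGmorphism_point :
  is_bGmorphism (point_filter : X -> spec_space (clopup_alg X)).
Proof.
split.
- exact: point_filter_continuous.
- by move=> x y /(point_filter_le priestleyX).
- move=> x P; have [y <-] := point_filter_surj priestleyX P.
  by move=> /(point_filter_le priestleyX) xy; exists y.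
- by move=> _ [x Dx <-] /=; apply.
- by move=> _ [x nDx <-] /=; apply.
Qed.

Definition point_morphism : bGmorphism X (spec_space (clopup_alg X)) :=
  BGMorphism is_bGmorphism_point.

Lemma point_morphism_bij : bijective point_morphism.
Proof.
rewrite -setTT_bijective; split=> // [x y _ _|P _].
  exact: point_filter_inj priestleyX _ _.
by have [x xP] := point_filter_surj priestleyX P; exists x.
Qed.

End PointMorphism.

Lemma point_morphism_natural (X Y : bGS) (f : bGmorphism X Y) :
  bGm_comp (point_morphism Y) f =
  bGm_comp (spec_map (clopup_map f)) (point_morphism X).
Proof. by apply/bGm_eq/funext => x; exact: val_inj. Qed.

Theorem mainTheorem9 : dually_equivalent bGA bGS.
Proof.
exists spec_functor, clopup_functor; split; apply: naturally_isomorphic_sym.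
- exists stone_hom; split=> [A B h|A]; first exact: stone_hom_natural.
  exact/is_iso_opposite/bGhom_bij_iso/stone_hom_bij.
- exists point_morphism; split; first exact: point_morphism_natural.
  by move=> X; exact/bGm_bij_iso/point_morphism_bij.
Qed.
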